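(* Let $n\ge 3$ be an integer and let $r\in\{0,1,\dots,9\}$ be such that $n\equiv r\pmod{10}$. Then $$ \gamma_{\times 3,t}(K_n \Box K_n)= \begin{cases} 2n+2\lfloor \frac{n}{10} \rfloor+2 & \text{if } r\in\{4,5,6,7,8,9\},\\ 2n+2\lfloor \frac{n}{10} \rfloor+\lceil \frac{r}{3}\rceil & \text{if } r\in\{0,1,2,3\} \text{ and } n\ne 3,\\ 8 & \text{if } n=3. \end{cases} $$
   Context: All graphs are finite, undirected and simple. $K_n$ is the complete graph on $n$ vertices. The Cartesian product $G\Box H$ has vertex set $V_G\times V_H$, with $(u_1,v_1)$ and $(u_2,v_2)$ adjacent if and only if either $u_1=u_2$ and $v_1v_2\in E_H$, or $v_1=v_2$ and $u_1u_2\in E_G$. For an integer $k\ge1$, a $k$-tuple total dominating set ($k$TDS) of a graph $G$ is a set $S\subseteq V_G$ such that every vertex $v\in V_G$ (including the vertices in $S$) has at least $k$ neighbours in $S$. The $k$-tuple total domination number $\gamma_{\times k,t}(G)$ is the minimum cardinality of a $k$TDS of $G$. *)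

(* Defs.v *)
From mathcomp Require Import all_boot.

Set Implicit Arguments.
Unset Strict Implicit.
Unset Printing Implicit Defensive.

Record sgraph := SGraph {
  vertex :> finType;
  adj : rel vertex;
  adj_sym : symmetric adj;
  adj_irr : irreflexive adj
}.

Section Complete.
Variable n : nat.

Definition complete_adj : rel 'I_n := fun u v => u != v.

Lemma complete_adj_sym : symmetric complete_adj.
Proof. by move=> u v; rewrite /complete_adj eq_sym. Qed.

Lemma complete_adj_irr : irreflexive complete_adj.
Proof. by move=> u; rewrite /complete_adj eqxx. Qed.

Definition complete_graph : sgraph := SGraph complete_adj_sym complete_adj_irr.

End Complete.

Section CartesianProduct.
Variables G H : sgraph.

Definition cart_adj : rel (G * H)%type := fun p q =>
  (p.1 == q.1) && adj p.2 q.2 || (p.2 == q.2) && adj p.1 q.1.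

Lemma cart_adj_sym : symmetric cart_adj.
Proof.
move=> p q; rewrite /cart_adj (eq_sym p.1) (eq_sym p.2).
by rewrite (adj_sym p.1) (adj_sym p.2).
Qed.

Lemma cart_adj_irr : irreflexive cart_adj.
Proof. by move=> p; rewrite /cart_adj !adj_irr !andbF. Qed.

Definition cart_graph : sgraph := SGraph cart_adj_sym cart_adj_irr.

End CartesianProduct.

Definition ktds (k : nat) (G : sgraph) (S : {set G}) : bool :=
  [forall v : G, k <= #|[set u in S | adj v u]|].

(* Supersets of k-tuple total dominating sets are again such sets, so one
   exists iff [set: G] is one. When none exists the value below is
   meaningless. *)
Definition ktd_number (k : nat) (G : sgraph) : nat :=
  #|[arg min_(S < [set: G] | ktds k S) #|S|]|.

Lemma ktds_superset (k : nat) (G : sgraph) (S T : {set G}) :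
  S \subset T -> ktds k S -> ktds k T.
Proof.
move=> sST /forallP dS; apply/forallP => v; apply: leq_trans (dS v) _.
apply: subset_leq_card; apply/subsetP => u; rewrite !inE => /andP[uS ->].
by rewrite (subsetP sST).
Qed.

Lemma ktd_numberP (k : nat) (G : sgraph) :
  (exists S : {set G}, ktds k S) ->
  (exists2 S : {set G}, ktds k S & #|S| = ktd_number k G) /\
  (forall S : {set G}, ktds k S -> ktd_number k G <= #|S|).
Proof.
case=> S0 dS0; have dT := ktds_superset (subsetT S0) dS0.
by rewrite /ktd_number; case: arg_minnP => // S dS minS; split=> //; exists S.
Qed.

Definition ceil_divn (m d : nat) : nat := m %/ d + ~~ (d %| m).

(* Main.v *)
(** A set of cells of the grid is 3-tuple total dominating iff every row sum and
    column sum add up to at least 3, and to at least 5 at the cells of the set.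
    Hence all row sums or all column sums are at least 2; say the latter, and
    write the size of the set as [2n + e]. Rows of sum 1 only meet columns of
    sum at least 4, and rows of sum 2 only columns of sum at least 3. Double
    counting then gives [n <= 5e], with a gain of 2 when [e] is odd. Conversely,
    one takes [p] columns with at least 4 cells each, alone in their rows, and
    spreads two cells per remaining column evenly over the remaining rows. *)
Require Import Defs.
From mathcomp Require Import all_boot.
From mathcomp Require Import zify.

Set Implicit Arguments.
Unset Strict Implicit.
Unset Printing Implicit Defensive.

(** * Row and column sums as fibre sizes *)

Section FiberDegree.
Variables (T I : finType) (f : T -> I) (S : {set T}).

Definition deg (i : I) : nat := #|[set u in S | f u == i]|.

Lemma sum_deg (P : pred I) :
  \sum_(i | P i) deg i = #|[set u in S | P (f u)]|.
Proof.
rewrite -sum1_card (partition_big f P) => [|u]; last by rewrite inE => /andP[].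
apply: eq_bigr => i Pi; rewrite /deg -sum1_card; apply: eq_bigl => u.
by rewrite !inE; case: eqP => [->|_]; rewrite ?Pi ?andbT ?andbF.
Qed.

Lemma sum_deg_all : \sum_i deg i = #|S|.
Proof. by rewrite sum_deg; apply: eq_card => u; rewrite !inE andbT. Qed.

End FiberDegree.

(** Each side counts elements of [S], by [f]-fibre or by [g]-fibre. *)
Lemma sum_deg_le (T I J : finType) (f : T -> I) (g : T -> J) (S : {set T})
    (P : pred I) (Q : pred J) :
  (forall u, u \in S -> P (f u) -> Q (g u)) ->
  \sum_(i | P i) deg f S i <= \sum_(j | Q j) deg g S j.
Proof.
move=> PQ; rewrite !sum_deg; apply/subset_leq_card/subsetP => u.
by rewrite !inE => /andP[uS Pu]; rewrite uS PQ.
Qed.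

(** * Lower bound by double counting *)

Section LowerBound.
Variables (T I J : finType) (f : T -> I) (g : T -> J) (S : {set T}) (n : nat).
Hypotheses (cardI : #|I| = n) (cardJ : #|J| = n) (n_ge3 : 3 <= n).
Hypothesis deg_ge3 : forall i j, 3 <= deg f S i + deg g S j.
Hypothesis deg_ge5 : forall u, u \in S -> 5 <= deg f S (f u) + deg g S (g u).

Lemma card_excess_col :
  (forall j, 2 <= deg g S j) ->
  exists e, [/\ #|S| = 2 * n + e, 2 <= e & n + 2 * odd e <= 5 * e].
Proof.
move=> c_ge2; set r := deg f S; set c := deg g S.
(* An empty row forces every column sum to be at least 3. *)
have [/existsP[i0 /eqP r0]|] := boolP [exists i, r i == 0].
  have : 3 * n <= #|S|.
    rewrite -(sum_deg_all g) -cardJ mulnC -sum_nat_const.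
    by apply: leq_sum => j _; have := deg_ge3 i0 j; rewrite -/r r0.
  by move=> le3; exists (#|S| - 2 * n); case: odd; split; lia.
rewrite negb_exists => /forallP r_gt0.
pose m3 := \sum_j (c j == 3); pose p := \sum_j (4 <= c j).
pose B := \sum_(j | 4 <= c j) (c j - 2).
pose W1 := \sum_(i | r i == 1) r i; pose W2 := \sum_(i | r i <= 2) r i.
pose T4 := \sum_(j | 4 <= c j) c j; pose T3 := \sum_(j | 3 <= c j) c j.
have W1T : W1 <= T4.
  apply: (@sum_deg_le _ _ _ f g S (fun i => r i == 1) (fun j => 4 <= c j)).
  by move=> u uS /eqP ru; have := deg_ge5 uS; rewrite -/r -/c ru.
have W2T : W2 <= T3.
  apply: (@sum_deg_le _ _ _ f g S (fun i => r i <= 2) (fun j => 3 <= c j)).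
  by move=> u uS ru; have := deg_ge5 uS; rewrite -/r -/c; lia.
(* The weights are chosen so that rows of sum 1, 2 and 3 each contribute exactly 6. *)
have rowS : 6 * n <= 2 * #|S| + 3 * W1 + W2.
  rewrite -(sum_deg_all f) -cardI /W1 /W2 mulnC -sum_nat_const.
  rewrite (big_mkcond (fun i => r i == 1)) (big_mkcond (fun i => r i <= 2)).
  rewrite !big_distrr -!big_split; apply: leq_sum => i _ /=.
  by have := r_gt0 i; rewrite -/r; case: (r i) => [|[|[|k]]] //=; lia.
have cardS : #|S| = 2 * n + (m3 + B).
  rewrite -(sum_deg_all g) -cardJ mulnC -sum_nat_const /B /m3.
  rewrite (big_mkcond (fun j => 4 <= c j)) -!big_split.
  apply: eq_bigr => j _ /=.
  by have := c_ge2 j; rewrite -/c; case: (c j) => [|[|[|[|k]]]] //=; lia.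
have T3E : T3 = T4 + 3 * m3.
  rewrite /T3 /T4 /m3 big_mkcond (big_mkcond (fun j => 4 <= c j)).
  rewrite big_distrr -big_split.
  by apply: eq_bigr => j _; case: (c j) => [|[|[|[|k]]]] //=; lia.
have T4E : T4 = B + 2 * p.
  rewrite /T4 /B /p !(big_mkcond (fun j => 4 <= c j)) big_distrr -big_split.
  by apply: eq_bigr => j _; case: (c j) => [|[|[|[|k]]]] //=; lia.
have T4_ge : 4 * p <= T4.
  rewrite /T4 /p (big_mkcond (fun j => 4 <= c j)) big_distrr.
  by apply: leq_sum => j _; case: (c j) => [|[|[|[|k]]]] //=; lia.
(* Since [B >= 2 * p], this excludes [B = 1]; it is what rules out [e = 1] when [n = 3]. *)
have B_ge : (B == 0) || (0 < p).
  case: (posnP p) => [/eqP|]; last by rewrite orbT.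
  rewrite /p sum_nat_eq0 => /forallP p0; rewrite orbF /B big_pred0 // => j.
  by have := p0 j; case: (4 <= c j).
(* Combining the counts, [2 * n <= 5 * m3 + 6 * B + 8 * p], and [2 * p <= B], so
   [2 * n <= 5 * m3 + 10 * B]. If [e] is odd, either [m3 > 0] or [B >= 2 * p + 1]; both give the
   gain of 2. *)
exists (m3 + B); have := odd_double_half (m3 + B).
by case: (odd _) => /= eE; split; lia.
Qed.

End LowerBound.

Lemma card_excess (T I J : finType) (f : T -> I) (g : T -> J) (S : {set T}) n :
  #|I| = n -> #|J| = n -> 3 <= n ->
  (forall i j, 3 <= deg f S i + deg g S j) ->
  (forall u, u \in S -> 5 <= deg f S (f u) + deg g S (g u)) ->
  exists e, [/\ #|S| = 2 * n + e, 2 <= e & n + 2 * odd e <= 5 * e].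
Proof.
move=> cardI cardJ n_ge3 ge3 ge5.
have [/forallP c2|] := boolP [forall j, 2 <= deg g S j].
  exact: card_excess_col ge3 ge5 c2.
rewrite negb_forall => /existsP[j0 cj0].
(* A column of sum at most 1 makes all row sums at least 2: exchange rows and columns. *)
apply: (@card_excess_col _ J I g f S n) => // [j i|u uS|i].
- by rewrite addnC.
- by rewrite addnC ge5.
- by have := ge3 i j0; lia.
Qed.

(** * Domination in terms of row and column sums *)

Section RookGraph.
Variable n : nat.
Let G := cart_graph (complete_graph n) (complete_graph n).
Implicit Types (S : {set G}) (v : G).

(** A neighbour shares exactly one coordinate with [v], whereas [v] itself is counted in both its
    row and its column. *)
Lemma card_rook_neighbours S v :
  #|[set u in S | adj v u]| + 2 * (v \in S) = deg fst S v.1 + deg snd S v.2.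
Proof.
have vE : (v \in S : nat) = \sum_(u in S) (u == v).
  have [vS|vS] := boolP (v \in S); last first.
    by rewrite big1 // => u uS; case: eqP uS vS => // -> ->.
  by rewrite (bigD1 v) //= eqxx big1 // => u /andP[_ /negbTE->].
have cardE (P : pred G) : #|[set u in S | P u]| = \sum_(u in S) P u.
  rewrite -sum1_card (eq_bigl (fun u => (u \in S) && P u)) => [|u].
    by rewrite big_mkcondr; apply: eq_bigr => u _; case: (P u).
  by rewrite inE.
rewrite vE /deg !cardE big_distrr -!big_split; apply: eq_bigr => -[a b] _ /=.
case: v {vE} => i j; rewrite xpair_eqE /cart_adj /= /complete_adj.
by rewrite (eq_sym i) (eq_sym j); case: (a == i); case: (b == j).
Qed.

Lemma ktds_rookE S :
  ktds 3 S = [forall v : G, 3 + 2 * (v \in S) <= deg fst S v.1 + deg snd S v.2].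
Proof.
by apply: eq_forallb => v; rewrite -card_rook_neighbours leq_add2r.
Qed.

Lemma ktds_rook_card S :
  3 <= n -> ktds 3 S ->
  exists e, [/\ #|S| = 2 * n + e, 2 <= e & n + 2 * odd e <= 5 * e].
Proof.
rewrite ktds_rookE => n_ge3 /forallP dS.
apply: (@card_excess G 'I_n 'I_n fst snd S n (card_ord n) (card_ord n))
  => // [i j|u uS].
  by have := dS (i, j); apply: leq_trans; rewrite leq_addr.
by have := dS u; rewrite uS.
Qed.

(** * Sets given by lists of cells *)

Definition row_count (L : seq (nat * nat)) (i : nat) :=
  count (fun b => (i, b) \in L) (iota 0 n).
Definition col_count (L : seq (nat * nat)) (j : nat) :=
  count (fun a => (a, j) \in L) (iota 0 n).

(** Natural coordinates make the hypothesis computable on a fixed grid. Repeated or outside cells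
    may occur in [L], hence only an inequality. *)
Lemma ktds_of_cells (L : seq (nat * nat)) :
  allrel (fun i j => 3 + 2 * ((i, j) \in L) <= row_count L i + col_count L j)
    (iota 0 n) (iota 0 n) ->
  exists2 S : {set G}, ktds 3 S & #|S| <= size L.
Proof.
move/allrelP => dL.
pose S : {set G} := [set u | (val u.1, val u.2) \in L].
have count_le (P : pred nat) (h : 'I_n -> G) (A : {set G}) :
    injective h -> (forall a : 'I_n, P a -> h a \in A) ->
  count P (iota 0 n) <= #|A|.
  move=> h_inj hA; rewrite -val_enum_ord count_map -size_filter.
  rewrite -(size_map h) cardE; apply: uniq_leq_size.
    by rewrite map_inj_uniq // filter_uniq // enum_uniq.
  move=> _ /mapP[a aP ->]; move: aP.
  by rewrite mem_filter mem_enum => /andP[/hA].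
exists S.
  rewrite ktds_rookE; apply/forallP => -[i j] /=.
  have := dL (val i) (val j); rewrite !mem_iota !ltn_ord => /(_ isT isT).
  rewrite inE /=; move/leq_trans; apply; rewrite leq_add //.
    apply: (count_le _ (fun b => (i, b))) => [b b' []//|b bL].
    by rewrite !inE eqxx andbT.
  apply: (count_le _ (fun a => (a, j))) => [a a' []//|a aL].
  by rewrite !inE eqxx andbT.
pose h (u : G) := (val u.1, val u.2).
have h_inj : injective h.
  by move=> [a b] [c d] [/val_inj-> /val_inj->].
rewrite cardE -(size_map h); apply: uniq_leq_size.
  by rewrite map_inj_uniq ?enum_uniq.
by move=> _ /mapP[u uS ->]; move: uS; rewrite mem_enum inE.
Qed.

Lemma count_iota_ge (P : pred nat) (s : seq nat) :
  uniq s -> all (fun b => (b < n) && P b) s -> size s <= count P (iota 0 n).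
Proof.
move=> s_uniq /allP sP; rewrite -size_filter; apply: uniq_leq_size => // b bs.
by have /andP[bn Pb] := sP b bs; rewrite mem_filter Pb mem_iota.
Qed.

(* [m] rows of sum 1, dealt cyclically to the first [p] columns; the cells of
   the other columns, two per column, are dealt cyclically to the other rows. *)
Lemma ktds_dealt (p m : nat) :
  0 < p -> 4 * p <= m -> m + 2 <= n -> 3 * (n - m) <= 2 * (n - p) ->
  exists2 S : {set G}, ktds 3 S & #|S| <= m + 2 * (n - p).
Proof.
move=> p_gt0 pm mn mp; set k := n - m.
pose L := [seq (i, i %% p) | i <- iota 0 m]
       ++ [seq (m + t %% k, p + t %/ 2) | t <- iota 0 (2 * (n - p))].
(* With [k > 1], consecutive cells [t] and [t.+1] fall in distinct rows. *)
have k_gt1 : 1 < k by rewrite /k; lia.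
have L1 i j : i < m -> i %% p = j -> (i, j) \in L.
  move=> im <-; rewrite mem_cat; apply/orP; left.
  by apply/mapP; exists i; rewrite // mem_iota.
have L2 t i j : t < 2 * (n - p) -> m + t %% k = i -> p + t %/ 2 = j ->
    (i, j) \in L.
  move=> tn <- <-; rewrite mem_cat; apply/orP; right.
  by apply/mapP; exists t; rewrite // mem_iota.
have L_block i j : (i, j) \in L -> (i < m /\ j < p) \/ (m <= i /\ p <= j).
  rewrite mem_cat => /orP[] /mapP[t]; rewrite mem_iota => /andP[_ tlt] [-> ->].
    by left; rewrite ltn_mod.
  by right; rewrite !leq_addr.
have row1 i : i < m -> 1 <= row_count L i.
  move=> im; apply: (@count_iota_ge _ [:: i %% p]) => //=.
  by rewrite L1 // andbT (leq_trans (ltn_pmod _ p_gt0)) //; lia.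
have row3 i : m <= i < n -> 3 <= row_count L i.
  move=> /andP[mi i_n]; pose x := i - m; have xk : x < k by rewrite /x /k; lia.
  (* The cells numbered [x], [k + x] and [2 * k + x] return to row [i]; they exist because
     [3 * k <= 2 * (n - p)]. *)
  apply: (@count_iota_ge _
    [:: p + x %/ 2; p + (k + x) %/ 2; p + (k + (k + x)) %/ 2]).
    by rewrite /= !inE; lia.
  have in_row t : t < 2 * (n - p) -> t = x %[mod k] ->
      (p + t %/ 2 < n) && ((i, p + t %/ 2) \in L).
    move=> t_lt tx; rewrite (L2 t) // ?andbT; first lia.
    by rewrite tx modn_small // /x; lia.
  by rewrite /= !in_row ?modnDl // /k; lia.
have col4 j : j < p -> 4 <= col_count L j.
  move=> jp.
  apply: (@count_iota_ge _ [:: j; p + j; p + (p + j); p + (p + (p + j))]).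
    by rewrite /= !inE; lia.
  by rewrite /= !L1 ?modnDl ?modn_small //; lia.
have col2 j : p <= j < n -> 2 <= col_count L j.
  move=> /andP[pj jn]; pose t := 2 * (j - p).
  apply: (@count_iota_ge _ [:: m + t %% k; m + t.+1 %% k]).
    rewrite /= inE andbT eqn_add2l -addn1 -{1}[t]addn0 eqn_modDl.
    by rewrite mod0n modn_small.
  rewrite /= (L2 t) ?(L2 t.+1) // /t; lia.
have -> : m + 2 * (n - p) = size L by rewrite size_cat !size_map !size_iota.
apply: ktds_of_cells; apply/allrelP => i j; rewrite !mem_iota => i_n jn.
have [/L_block[[im jp]|[mi pj]]|_] := boolP ((i, j) \in L).
- by rewrite (leq_add (row1 i im) (col4 j jp)).
- by rewrite (leq_add (row3 i _) (col2 j _)) //; lia.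
- have [im|mi] := ltnP i m; last first.
    by rewrite (leq_trans (row3 i _)) ?leq_addr //; lia.
  have [jp|pj] := ltnP j p.
    by rewrite (leq_trans (_ : 3 <= 4)) // (leq_trans (col4 j jp)) ?leq_addl.
  by rewrite (leq_add (row1 i im) (col2 j _)) //; lia.
Qed.

End RookGraph.

Lemma ktds_rook_exists n (G := complete_graph n) : 3 <= n ->
  exists2 S : {set cart_graph G G}, ktds 3 S &
    #|S| <= 2 * n + 2 * (n %/ 10)
            + (if n == 3 then 2 else if 4 <= n %% 10 then 2 else 0 < n %% 10).
Proof.
move=> n_ge3; rewrite {}/G.
have [n5|n_gt5] := leqP n 5.
  (* Dealing needs [4 <= m] and [m + 2 <= n], so these grids are listed and checked by
     computation. *)
  have [->|[->|->]] : n = 3 \/ n = 4 \/ n = 5 by lia.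
  - exact: (@ktds_of_cells 3
      [:: (0,1); (0,2); (1,0); (1,1); (1,2); (2,0); (2,1); (2,2)]).
  - exact: (@ktds_of_cells 4
      [:: (0,0); (0,2); (0,3); (1,1); (1,2); (1,3);
          (2,0); (2,1); (3,0); (3,1)]).
  - exact: (@ktds_of_cells 5
      [:: (0,0); (0,1); (0,2); (1,0); (1,1); (1,2);
          (2,3); (2,4); (3,3); (3,4); (4,3); (4,4)]).
have nE := divn_eq n 10; have := ltn_pmod n (isT : 0 < 10).
move: (n %/ 10) (n %% 10) nE => q r nE r_lt; rewrite gtn_eqF; last by lia.
(* The row condition amounts to [n + 2 * p <= 3 * m]. For [p = q] it reads [12 * q + r <= 3 * m], so
   [m = 4 * q] serves [r = 0] and one more row serves [r <= 3]. *)
have [r4|r4] := leqP 4 r.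
  have [||||S dS le_S] := @ktds_dealt n q.+1 (4 * q.+1); try lia.
  by exists S => //; apply: leq_trans le_S _; lia.
have [r0|r_gt0] := posnP r.
  have [||||S dS le_S] := @ktds_dealt n q (4 * q); try lia.
  by exists S => //; apply: leq_trans le_S _; lia.
have [||||S dS le_S] := @ktds_dealt n q (4 * q).+1; try lia.
by exists S => //; apply: leq_trans le_S _; lia.
Qed.

Theorem theorem5p1 (n r : nat) (n_ge3 : 3 <= n) (r_le9 : r <= 9)
    (n_mod : n = r %[mod 10]) :
  let gamma := ktd_number 3 (cart_graph (complete_graph n) (complete_graph n)) in
  [/\ r \in [:: 4; 5; 6; 7; 8; 9] -> gamma = 2 * n + 2 * (n %/ 10) + 2,
      r \in [:: 0; 1; 2; 3] -> n <> 3 ->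
        gamma = 2 * n + 2 * (n %/ 10) + ceil_divn r 3
    & n = 3 -> gamma = 8].
Proof.
have r_eq : n %% 10 = r by rewrite n_mod modn_small.
have [S dS leS] := ktds_rook_exists n_ge3.
have [[S0 dS0 S0E] minS] := ktd_numberP (ex_intro _ S dS).
have [e [S0_card e_ge2 e_odd]] := ktds_rook_card n_ge3 dS0.
have := leq_trans (minS S dS) leS.
rewrite /= -S0E S0_card r_eq {minS S0E S0_card n_mod} => e_le.
have nE := divn_eq n 10; rewrite {}r_eq in nE.
have eE := odd_double_half e.
move: (n %/ 10) nE e_le => q nE e_le.
split=> [|r_in n_neq3|n3]; last by rewrite n3 /= in e_le *; lia.
(* Here [e >= 2 * q + 1], and equality, being odd, would need [r + 2 <= 5]. *)
- rewrite !inE => r_in.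
  by move: e_le; case: (odd e) e_odd eE => /=; do 2?case: ifP; lia.
- have -> : ceil_divn r 3 = (0 < r).
    by case: r r_in {r_le9 nE e_le} => [|[|[|[|r]]]].
  rewrite !inE in r_in.
  by move: e_le; case: (odd e) e_odd eE => /=; do 2?case: ifP; lia.
Qed.
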